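(* Consider the dynamics $\dot{\mathbf{x}}=F(\mathbf{x})\underline{\mathbf{u}}$ with posterior distribution $F(\mathbf{x})\underline{\mathbf{u}}\sim\mathcal{GP}\big(\mathbf{M}_k(\mathbf{x})\underline{\mathbf{u}},\ (\underline{\mathbf{u}}^\top\mathbf{B}_k(\mathbf{x},\mathbf{x}')\underline{\mathbf{u}})\,\mathbf{A}\big)$. Given $\mathbf{x}_k$ and $\mathbf{u}_k$, the quantity $\mathrm{CBC}_k=\mathrm{CBC}(\mathbf{x}_k,\mathbf{u}_k)$ is a Gaussian random variable with $$\mathbb{E}[\mathrm{CBC}_k]=\nabla_{\mathbf{x}}h(\mathbf{x}_k)^\top\mathbf{M}_k(\mathbf{x}_k)\underline{\mathbf{u}}_k+\alpha(h(\mathbf{x}_k)),$$ $$\mathrm{Var}[\mathrm{CBC}_k]=\big(\underline{\mathbf{u}}_k^\top\mathbf{B}_k(\mathbf{x}_k,\mathbf{x}_k)\underline{\mathbf{u}}_k\big)\big(\nabla_{\mathbf{x}}h(\mathbf{x}_k)^\top\mathbf{A}\nabla_{\mathbf{x}}h(\mathbf{x}_k)\big).$$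
   Context: $F(\mathbf{x})=[f(\mathbf{x})\ g(\mathbf{x})]\in\mathbb{R}^{n\times(1+m)}$ is random, $\underline{\mathbf{u}}=[1,\mathbf{u}^\top]^\top\in\mathbb{R}^{1+m}$. $\mathbf{M}_k(\mathbf{x})\in\mathbb{R}^{n\times(1+m)}$, $\mathbf{A}\in\mathbb{R}^{n\times n}$ and $\mathbf{B}_k(\mathbf{x},\mathbf{x})\in\mathbb{R}^{(1+m)\times(1+m)}$ are symmetric positive semidefinite (for the latter two). $h$ is a known continuously differentiable real-valued function, $\alpha$ is an extended class $K_\infty$ function, and the control barrier condition is $\mathrm{CBC}(\mathbf{x},\mathbf{u})=\mathcal{L}_fh(\mathbf{x})+\mathcal{L}_gh(\mathbf{x})\mathbf{u}+\alpha(h(\mathbf{x}))=\nabla_{\mathbf{x}}h(\mathbf{x})^\top F(\mathbf{x})\underline{\mathbf{u}}+\alpha(h(\mathbf{x}))$, with $\mathcal{L}$ denoting the Lie derivative. A Gaussian with zero variance is a constant. *)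

(* Defs.v *)
From HB Require Import structures.
From mathcomp Require Import all_boot all_order all_algebra.
From mathcomp Require Import all_classical all_reals all_analysis.
Set Implicit Arguments.
Unset Strict Implicit.
Unset Printing Implicit Defensive.
Import Order.TTheory GRing.Theory Num.Theory.
Import numFieldNormedType.Exports.
Local Open Scope classical_set_scope.
Local Open Scope ring_scope.

(* normal_prob m s takes the standard deviation s, and for s = 0 it is the
   uniform law on [0, 1]; the degenerate Gaussian has to be the point mass. *)
Definition gaussian_law (R : realType) (m v : R) : set R -> \bar R :=
  fun A => if v == 0 then \d_m A else normal_prob m (Num.sqrt v) A.

Definition gaussian_rv d (T : measurableType d) (R : realType)
    (P : probability T R) (X : T -> R) : Prop :=
  measurable_fun [set: T] X /\
  exists m v : R, 0 <= v /\
    forall A : set R, measurable A -> P (X @^-1` A) = gaussian_law m v A.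

(* Joint Gaussianity in the sense that covers singular covariance matrices:
   every linear combination of the components is a (possibly degenerate)
   Gaussian variable. *)
Definition jointly_gaussian d (T : measurableType d) (R : realType)
    (P : probability T R) (I : finType) (X : I -> T -> R) : Prop :=
  forall a : I -> R, gaussian_rv P (fun w => \sum_i a i * X i w).

(* X ~ GP(mu, K) for an R^p-valued process indexed by S, with matrix-valued
   kernel K s s' = Cov(X s, X s'). *)
Definition gaussian_process d (T : measurableType d) (R : realType)
    (P : probability T R) (S : Type) (p : nat) (X : S -> T -> 'cV[R]_p)
    (mu : S -> 'cV[R]_p) (K : S -> S -> 'M[R]_p) : Prop :=
  [/\ forall (N : nat) (s : 'I_N -> S),
        jointly_gaussian P
          (fun (k : 'I_N * 'I_p) (w : T) => X (s k.1) w k.2 0),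
      forall (s : S) (i : 'I_p),
        ('E_P[(fun w => X s w i 0)%R] = (mu s i 0)%R%:E)%E &
      forall (s s' : S) (i j : 'I_p),
        covariance P (fun w => X s w i 0) (fun w => X s' w j 0)
          = (K s s' i j)%:E].

Definition sym_psd (R : realType) (n : nat) (A : 'M[R]_n) : Prop :=
  A^T = A /\ forall v : 'cV[R]_n, 0 <= (v^T *m A *m v) 0 0.

Definition gradient (R : realType) (n : nat) (h : 'cV[R]_n -> R)
    (x : 'cV[R]_n) : 'cV[R]_n :=
  \col_i 'D_(delta_mx i 0) h x.

Definition continuously_differentiable (R : realType) (n : nat)
    (h : 'cV[R]_n -> R) : Prop :=
  (forall x, differentiable h x) /\ continuous (gradient h).

Definition extended_class_Kinfty (R : realType) (alpha : R -> R) : Prop :=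
  [/\ continuous alpha,
      {homo alpha : x y / x < y},
      alpha 0 = 0,
      alpha x @[x --> +oo] --> +oo &
      alpha x @[x --> -oo] --> -oo].

Definition lie_derivative (R : realType) (n : nat) (h : 'cV[R]_n -> R)
    (f : 'cV[R]_n -> 'cV[R]_n) (x : 'cV[R]_n) : R :=
  'D_(f x) h x.

Definition lie_derivative_row (R : realType) (n m : nat) (h : 'cV[R]_n -> R)
    (g : 'cV[R]_n -> 'M[R]_(n, m)) (x : 'cV[R]_n) : 'rV[R]_m :=
  \row_j lie_derivative h (fun y => col j (g y)) x.

Definition ext_input (R : realType) (m : nat) (u : 'cV[R]_m) : 'cV[R]_(1 + m) :=
  col_mx 1%:M u.

(* F = [f g]: the drift f is the first column and g the last m columns. *)
Definition CBC (R : realType) (n m : nat) (h : 'cV[R]_n -> R) (alpha : R -> R)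
    (F : 'cV[R]_n -> 'M[R]_(n, 1 + m)) (x : 'cV[R]_n) (u : 'cV[R]_m) : R :=
  lie_derivative h (fun y => lsubmx (F y)) x
  + (lie_derivative_row h (fun y => rsubmx (F y)) x *m u) 0 0
  + alpha (h x).

(* Main.v *)
(* The control barrier condition is an affine function, with deterministic
   coefficients, of the Gaussian vector F(x) u: the directional derivatives of
   the differentiable function h are linear in the direction, so CBC equals
   grad h . (F u) + alpha (h x).  It remains to translate Gaussian laws and to
   use the bilinearity of the covariance.  The integrability that this needs is
   read off the finite covariances, so no Gaussian moment has to be computed. *)
Require Import Defs.
From HB Require Import structures.
From mathcomp Require Import all_boot all_order all_algebra.
From mathcomp Require Import all_classical all_reals all_analysis.
From mathcomp Require Import measurable_realfun ring lra.
Set Implicit Arguments.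
Unset Strict Implicit.
Unset Printing Implicit Defensive.
Import Order.TTheory GRing.Theory Num.Theory.
Import numFieldNormedType.Exports.
Local Open Scope classical_set_scope.
Local Open Scope ring_scope.

Lemma derive_gradient (R : realType) (n : nat) (h : 'cV[R]_n -> R)
    (x v : 'cV[R]_n) :
  differentiable h x -> 'D_v h x = ((gradient h x)^T *m v) 0 0.
Proof.
move=> hx.
have {1}-> : v = \sum_i v i 0 *: delta_mx i 0.
  by rewrite {1}(matrix_sum_delta v); apply: eq_bigr => i _; rewrite big_ord1.
rewrite deriveE// linear_sum mxE; apply: eq_bigr => i _.
by rewrite linearZ !mxE deriveE// mulrC.
Qed.

Lemma CBC_affine (R : realType) (n m : nat) (h : 'cV[R]_n -> R)
    (alpha : R -> R) (F : 'cV[R]_n -> 'M[R]_(n, 1 + m)) (x : 'cV[R]_n)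
    (u : 'cV[R]_m) :
  differentiable h x ->
  CBC h alpha F x u
  = \sum_i gradient h x i 0 * (F x *m ext_input u) i 0 + alpha (h x).
Proof.
move=> hx; rewrite /CBC /lie_derivative derive_gradient//; congr (_ + _).
have -> : lie_derivative_row h (fun y => rsubmx (F y)) x
    = (gradient h x)^T *m rsubmx (F x).
  apply/rowP => j; rewrite !mxE /lie_derivative derive_gradient// mxE.
  by apply: eq_bigr => i _; rewrite !mxE.
rewrite -mulmxA -(hsubmxK (F x)) mul_row_col mulmx1 hsubmxK.
rewrite !mxE -big_split/=; apply: eq_bigr => i _.
by rewrite !mxE mulrDr.
Qed.

Lemma sqr_integrable_Lfun2 d (T : measurableType d) (R : realType)
    (mu : {measure set T -> \bar R}) (f : T -> R) :
  measurable_fun [set: T] f ->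
  mu.-integrable [set: T] (fun x => (f x ^+ 2)%:E) -> f \in Lfun mu 2%:E.
Proof.
move=> mf /integrableP[_ f2].
rewrite inE; apply/andP; split; rewrite inE//= /finite_norm unlock.
rewrite poweR_lty//; move: f2; congr (_ < _)%E.
by apply: eq_integral => x _; rewrite /= normrX powR_mulrn.
Qed.

Lemma Lfun2_finite_variance d (T : measurableType d) (R : realType)
    (P : probability T R) (X : T -> R) :
  measurable_fun [set: T] X -> ('V_P[X] < +oo)%E -> X \in Lfun P 2%:E.
Proof.
move=> mX; rewrite /variance unlock => VX.
set c := fine _ in VX.
suff Xc2 : (X \- cst c) \in Lfun P 2%:E.
  have -> : X = (X \- cst c) + cst c by apply/funext => w; rewrite !fctE subrK.
  by rewrite rpredD// ?lee1n// => ?; exact: Lfun_cst.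
have mXc : measurable_fun [set: T] (X \- cst c) by exact: measurable_funB.
apply: sqr_integrable_Lfun2 => //; apply/integrableP; split.
  by apply/measurable_EFinP; exact: measurable_funX.
move: VX; rewrite unlock; congr (_ < _)%E.
by apply: eq_integral => w _; rewrite /= ger0_norm ?sqr_ge0// expr2.
Qed.

Lemma measurable_addr_cst (R : realType) (c : R) :
  measurable_fun [set: R] (+%R^~ c).
Proof. exact: measurable_funD. Qed.

Lemma pushforward_shift_lebesgue (R : realType) (c : R) (A : set R) :
  measurable A ->
  pushforward lebesgue_measure (+%R^~ c : _ -> measurableTypeR R) A
  = lebesgue_measure A.
Proof.
move=> mA; apply/esym; apply: lebesgue_measure_unique => //=.
  exact: measurable_addr_cst.
move=> _ _ [[a b] _ <-] /=; rewrite /pushforward.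
have -> : (fun x : R => x + c) @^-1` `]a, b] = `]a - c, b - c]%classic.
  by apply/seteqP; split => x /=; rewrite !in_itv/= ltrBlDr lerBrDr.
rewrite !lebesgue_measure_itv/= !lte_fin ltrD2r.
by case: ifP => // _; rewrite -!EFinB; congr EFin; lra.
Qed.

Lemma normal_pdf_shift (R : realType) (m s c x : R) : s != 0 ->
  normal_pdf (m + c) s (x + c) = normal_pdf m s x.
Proof.
by move=> s0; rewrite !normal_pdfE// /normal_fun opprD addrACA subrr addr0.
Qed.

Lemma gaussian_law_shift (R : realType) (m v c : R) (A : set R) :
  0 <= v -> measurable A ->
  gaussian_law m v ((fun x => x + c) @^-1` A) = gaussian_law (m + c) v A.
Proof.
rewrite le_eqVlt /gaussian_law => /predU1P[<- _|v0 mA]; first by rewrite eqxx.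
set s := Num.sqrt v; have s0 : s != 0 by rewrite gt_eqF// sqrtr_gt0.
rewrite gt_eqF// /normal_prob.
have mpdf : measurable_fun A (fun x : R => (normal_pdf (m + c) s x)%:E).
  apply/measurable_EFinP/(measurable_funS measurableT) => //.
  exact: measurable_normal_pdf.
under eq_integral do rewrite -(normal_pdf_shift m c _ s0)//.
rewrite -[LHS](@ge0_integral_pushforward _ _ _ _ _
  (+%R^~ c : measurableTypeR R -> measurableTypeR R)
  (measurable_addr_cst c) lebesgue_measure A
  (fun x => (normal_pdf (m + c) s x)%:E))//.
- apply: eq_measure_integral => //=; first exact: measurable_addr_cst.
  by move=> _ B mB _; exact: pushforward_shift_lebesgue.
- by move=> x _; rewrite lee_fin normal_pdf_ge0.
Qed.

Lemma gaussian_rvD_cst d (T : measurableType d) (R : realType)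
    (P : probability T R) (X : T -> R) (c : R) :
  gaussian_rv P X -> gaussian_rv P (fun w => X w + c).
Proof.
move=> [mX [m [v [v0 PX]]]]; split; first exact: measurable_funD.
exists (m + c), v; split=> // A mA.
rewrite -gaussian_law_shift// -PX// -[X in measurable X]setTI.
by apply: measurable_funD.
Qed.

Lemma lincombE (T : Type) (R : realType) (I : finType) (a : I -> R)
    (X : I -> T -> R) :
  (fun w => \sum_i a i * X i w) = \sum_i (a i \o* X i).
Proof.
apply/funext => w; rewrite fct_sumE; apply: eq_bigr => i _.
by rewrite /= mulrC.
Qed.

Lemma expectation_lincomb d (T : measurableType d) (R : realType)
    (P : probability T R) (I : finType) (a : I -> R) (X : I -> T -> R) :
  (forall i, X i \in Lfun P 1) ->
  ('E_P[(fun w => \sum_i a i * X i w)%R] = \sum_i (a i)%:E * 'E_P[X i])%E.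
Proof.
move=> X1; rewrite lincombE.
rewrite -(big_map (fun i => a i \o* X i) predT idfun) expectation_sum.
  by rewrite big_map; apply: eq_bigr => i _; rewrite expectationZl.
by move=> _ /mapP[i _ ->]; exact: Lfun_scale.
Qed.

Lemma Lfun_lincomb d (T : measurableType d) (R : realType)
    (P : probability T R) (I : finType) (a : I -> R) (X : I -> T -> R) :
  (forall i, X i \in Lfun P 2%:E) ->
  (fun w => \sum_i a i * X i w) \in Lfun P 2%:E.
Proof.
move=> X2; rewrite lincombE.
by rewrite rpred_sum ?lee1n// => ? i _; rewrite Lfun_scale ?ler1n.
Qed.

Lemma covariance_lincombl d (T : measurableType d) (R : realType)
    (P : probability T R) (I : finType) (a : I -> R) (X : I -> T -> R)
    (Y : T -> R) :
  (forall i, X i \in Lfun P 2%:E) -> Y \in Lfun P 2%:E ->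
  covariance P (fun w => \sum_i a i * X i w) Y
  = (\sum_i (a i)%:E * covariance P (X i) Y)%E.
Proof.
move=> X2 Y2.
have L21 (Z : T -> R) : Z \in Lfun P 2%:E -> Z \in Lfun P 1.
  by apply: Lfun_subset12; exact: fin_num_measure.
rewrite lincombE; elim: (index_enum I) => [|i r IH].
  by rewrite !big_nil; exact: covariance_cst_l.
rewrite !big_cons covarianceDl ?IH//.
- by rewrite covarianceZl ?Lfun2_mul_Lfun1 ?L21.
- by rewrite Lfun_scale ?ler1n.
- by rewrite rpred_sum ?lee1n// => ? j _; rewrite Lfun_scale ?ler1n.
Qed.

Lemma variance_lincomb d (T : measurableType d) (R : realType)
    (P : probability T R) (I : finType) (a : I -> R) (X : I -> T -> R)
    (K : I -> I -> R) :
  (forall i, X i \in Lfun P 2%:E) ->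
  (forall i j, covariance P (X i) (X j) = (K i j)%:E) ->
  ('V_P[(fun w => \sum_i a i * X i w)%R]
  = (\sum_i \sum_j a i * a j * K i j)%R%:E)%E.
Proof.
move=> X2 XK; rewrite /variance covariance_lincombl ?Lfun_lincomb//.
rewrite -sumEFin; apply: eq_bigr => i _; rewrite covarianceC covariance_lincombl//.
under eq_bigr do rewrite covarianceC XK -EFinM.
by rewrite sumEFin -EFinM mulr_sumr; under eq_bigr do rewrite mulrA.
Qed.

Lemma gaussian_process_lincomb d (T : measurableType d) (R : realType)
    (P : probability T R) (S : Type) (p : nat) (X : S -> T -> 'cV[R]_p)
    (mu : S -> 'cV[R]_p) (K : S -> S -> 'M[R]_p) (s : S) (a : 'I_p -> R) :
  gaussian_process P X mu K ->
  gaussian_rv P (fun w => \sum_i a i * X s w i 0).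
Proof.
case=> /(_ 1%N (fun=> s) (fun k => a k.2)) + _ _.
congr gaussian_rv; apply/funext => w.
by rewrite -(pair_bigA _ (fun _ i => a i * X s w i 0)) big_ord1.
Qed.

Lemma gaussian_process_measurable d (T : measurableType d) (R : realType)
    (P : probability T R) (S : Type) (p : nat) (X : S -> T -> 'cV[R]_p)
    (mu : S -> 'cV[R]_p) (K : S -> S -> 'M[R]_p) :
  gaussian_process P X mu K ->
  forall s i, measurable_fun [set: T] (fun w => X s w i 0).
Proof.
move=> GP s i; have [+ _] := gaussian_process_lincomb s (fun j => (j == i)%:R) GP.
congr measurable_fun; apply/funext => w.
rewrite (bigD1 i)//= eqxx mul1r big1 ?addr0// => j /negbTE ->.
by rewrite mul0r.
Qed.

Lemma gaussian_process_Lfun2 d (T : measurableType d) (R : realType)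
    (P : probability T R) (S : Type) (p : nat) (X : S -> T -> 'cV[R]_p)
    (mu : S -> 'cV[R]_p) (K : S -> S -> 'M[R]_p) :
  gaussian_process P X mu K ->
  forall s i, (fun w => X s w i 0) \in Lfun P 2%:E.
Proof.
move=> GP s i; apply: Lfun2_finite_variance.
  exact: gaussian_process_measurable GP _ _.
by case: GP => _ _ covX; rewrite /variance covX ltry.
Qed.

Theorem lemma2 (R : realType) (d : measure_display) (T : measurableType d)
    (P : probability T R) (n m : nat)
    (F : T -> 'cV[R]_n -> 'M[R]_(n, 1 + m))
    (M : 'cV[R]_n -> 'M[R]_(n, 1 + m))
    (A : 'M[R]_n)
    (B : 'cV[R]_n -> 'cV[R]_n -> 'M[R]_(1 + m))
    (h : 'cV[R]_n -> R) (alpha : R -> R)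
    (A_psd : sym_psd A)
    (B_psd : forall x : 'cV[R]_n, sym_psd (B x x))
    (h_C1 : continuously_differentiable h)
    (alpha_K : extended_class_Kinfty alpha)
    (F_GP : forall u : 'cV[R]_m,
       gaussian_process P
         (fun (x : 'cV[R]_n) (w : T) => F w x *m ext_input u)
         (fun x : 'cV[R]_n => M x *m ext_input u)
         (fun x x' : 'cV[R]_n =>
            (((ext_input u)^T *m B x x' *m ext_input u) 0 0) *: A))
    (xk : 'cV[R]_n) (uk : 'cV[R]_m) :
  let CBCk := fun w : T => CBC h alpha (F w) xk uk in
  [/\ gaussian_rv P CBCk,
      ('E_P[CBCk] = (((gradient h xk)^T *m M xk *m ext_input uk) 0 0
                      + alpha (h xk))%R%:E)%E &
      ('V_P[CBCk] = ((((ext_input uk)^T *m B xk xk *m ext_input uk) 0 0)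
                      * (((gradient h xk)^T *m A *m gradient h xk) 0 0))%R%:E)%E].
Proof.
move=> CBCk; have [h_diff _] := h_C1.
have GP := F_GP uk; have X2 := gaussian_process_Lfun2 GP xk.
set a := fun i => gradient h xk i 0.
set X := fun i w => (F w xk *m ext_input uk) i 0.
have CBCE : CBCk = (fun w => \sum_i a i * X i w) \+ cst (alpha (h xk)).
  by apply/funext => w; rewrite /CBCk CBC_affine.
have L21 (Z : T -> R) : Z \in Lfun P 2%:E -> Z \in Lfun P 1.
  by apply: Lfun_subset12; exact: fin_num_measure.
have [_ EX covX] := GP.
have Y2 := Lfun_lincomb a X2.
rewrite CBCE; split.
- exact/gaussian_rvD_cst/(gaussian_process_lincomb xk a GP).
- rewrite expectationD ?L21 ?Lfun_cst// expectation_cst EFinD; congr (_ + _)%E.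
  rewrite (expectation_lincomb a (X := X)); last by move=> i; exact/L21/X2.
  under eq_bigr do rewrite EX -EFinM.
  rewrite sumEFin -mulmxA mxE; congr EFin; apply: eq_bigr => i _.
  by rewrite [_^T _ _]mxE.
- rewrite varianceD_cst_r// (variance_lincomb a X2 (covX xk xk)).
  set b := ((ext_input uk)^T *m _ *m _) 0 0; congr EFin.
  rewrite mxE mulr_sumr exchange_big/=; apply: eq_bigr => j _.
  rewrite mxE big_distrl mulr_sumr/=; apply: eq_bigr => i _.
  by rewrite [_^T _ _]mxE [(_ *: A) _ _]mxE -/b /a; ring.
Qed.
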